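(* Let $u\in S_n$ and let $x\in G^{u,w_{\mathrm o}}$ be such that, for all $1\le i\le j\le n-1$, all positive quasiminors appearing in the identity below are defined and those that are inverted are nonzero. Then $$\Delta^{i,j}_{[1,i]\cup[n+i+1-j,n],[1,j]}(\psi^{u,w_{\mathrm o}}(x))^{-1}\,\Delta^{i,j+1}_{[1,i]\cup[n+i-j,n],[1,j+1]}(\psi^{u,w_{\mathrm o}}(x))=\Delta^{i,j}_{[1,i],[j+1-i,j]}(x)^{-1}\,\Delta^{i,j+1}_{[1,i],[j-i+2,j+1]}(x)$$ for all $1\le i\le j\le n-1$.
   Context: Let $\mathcal F$ be a skew field, $G=GL_n(\mathcal F)$, $[a,b]=\{a,a+1,\dots,b\}$ (empty if $a>b$), $w_{\mathrm o}=(n,n-1,\dots,1)$ the longest permutation in $S_n$. Quasideterminants: for a square matrix $A=(a_{ij})_{i\in I,j\in J}$, $|A|_{ij}=a_{ij}$ if $|I|=1$; otherwise, if $A^{ij}$ ($A$ with row $i$ and column $j$ deleted) is invertible, $|A|_{ij}=a_{ij}-r_i(A^{ij})^{-1}c_j$, where $r_i$ is row $i$ of $A$ without $a_{ij}$ and $c_j$ is column $j$ of $A$ without $a_{ij}$. Positive quasiminors: for $I,J\subset[1,n]$ with $|I|=|J|$, $i\in I$, $j\in J$, $\Delta^{i,j}_{I,J}(x)=(-1)^{d_i(I)+d_j(J)}|x_{I,J}|_{i,j}$, where $x_{I,J}$ is the submatrix with rows $I$ and columns $J$, and $d_i(I)$ (resp. $d_j(J)$) is the number of elements of $I$ greater than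 $i$ (resp. of $J$ greater than $j$). Groups: $B$ (resp. $B^-$) is the group of upper (resp. lower) triangular matrices in $G$, $H$ the diagonal matrices in $G$, $U$ the upper unitriangular matrices. Each $x\in B^-U$ is written uniquely as $x=[x]_-[x]_+$ with $[x]_-\in B^-$, $[x]_+\in U$. $S_n$ is embedded in $G$ as permutation matrices ($u e_k=e_{u(k)}$). Let $s_i=(i,i+1)$, let $\overline{s_i}\in G$ be the matrix with block $\begin{pmatrix}0&-1\\1&0\end{pmatrix}$ in rows and columns $i,i+1$ and identity elsewhere, and for $w\in S_n$ let $\overline w=\overline{s_{j_1}}\cdots\overline{s_{j_l}}$ for any reduced word $w=s_{j_1}\cdots s_{j_l}$ (independent of the choice). $G^{u,v}=BuB\cap B^-vB^-$, $L^{u,v}=U\overline uU\cap B^-vB^-$; every element of $G^{u,v}$ is uniquely $hx'$ with $h\in H$, $x'\in L^{u,v}$. Positive inverse: $x^\iota=J_nx^{-1}J_n$, $J_n=\mathrm{diag}(-1,1,-1,\dots,(-1)^n)$. Twist: for $x'\in L^{u,v}$, $\psi^{u,v}(x')=([x'\,\overline{v^{-1}}]_-)^\iota\,(x'^\iota)^{-1}\,([\overline u^{\,-1}x']_+)^\iota$, extended to $G^{u,v}$ by $\psi^{u,v}(hx')=h\psi^{u,v}(x')$. *)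

(* Defs.v *)
From HB Require Import structures.
From mathcomp Require Import all_boot all_order all_fingroup all_algebra.
From mathcomp Require Import boolp classical_sets.

Set Implicit Arguments.
Unset Strict Implicit.
Unset Printing Implicit Defensive.

Import GRing.Theory.

Local Open Scope ring_scope.
Local Open Scope classical_set_scope.

Definition skew_field (F : unitRingType) : Prop :=
  forall a : F, a != 0 -> a \is a GRing.unit.

(* [unitmx] and [invmx] are only available over commutative rings, so two-sided
   inverses are defined from scratch. The matrices may be rectangular (over a
   skew field only square ones are invertible): this avoids casts between
   #|I| and #|J| when A is a submatrix with rows I and columns J. *)
Section Inverse.
Variables (F : unitRingType) (m n : nat).
Implicit Types (A : 'M[F]_(m, n)) (B : 'M[F]_(n, m)).

Definition mx_inverse A B : Prop := A *m B = 1%:M /\ B *m A = 1%:M.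

Definition mx_invertible A : Prop := exists B, mx_inverse A B.

(* The inverse of A if A is invertible, 0 otherwise. *)
Definition mxinv A : 'M[F]_(n, m) := xget 0 [set B | mx_inverse A B].

End Inverse.

Section Quasideterminant.
Variables (F : unitRingType) (n : nat).
Implicit Types (x : 'M[F]_n) (I J : {set 'I_n}) (i j : 'I_n).

Definition submx_of x I J : 'M[F]_(#|I|, #|J|) :=
  mxsub (@enum_val _ (mem I)) (@enum_val _ (mem J)) x.

(* The quasideterminant |x_{I,J}|_{i,j}. If I = [set i] and J = [set j], the
   deleted submatrix is the (invertible) empty matrix and the value is x i j:
   see quasidet1_defined and quasidet1 below. *)
Definition quasidet_defined x I J i j : Prop :=
  [/\ #|I| = #|J|, i \in I, j \in J
    & mx_invertible (submx_of x (I :\ i) (J :\ j))].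

Definition quasidet x I J i j : F :=
  let r : 'rV[F]_#|J :\ j| := \row_l x i (enum_val l) in
  let c : 'cV[F]_#|I :\ i| := \col_k x (enum_val k) j in
  x i j - (r *m mxinv (submx_of x (I :\ i) (J :\ j)) *m c) 0 0.

Definition num_gt (I : {set 'I_n}) i : nat := #|[set k in I | (i < k)%N]|.

Definition qminor x I J i j : F :=
  (-1) ^+ (num_gt I i + num_gt J j) * quasidet x I J i j.

Lemma quasidet1_defined x i j : quasidet_defined x [set i]%SET [set j]%SET i j.
Proof.
split; rewrite ?cards1 ?set11 //.
have e (k : 'I_n) : #|([set k] :\ k)%SET| = 0%N.
  by rewrite finset.setDv cards0.
by exists 0; split; apply/matrixP => -[a la]; have := la; rewrite [X in (_ < X)%N]e.
Qed.

Lemma quasidet1 x i j : quasidet x [set i]%SET [set j]%SET i j = x i j.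
Proof.
rewrite /quasidet mxE big1 ?subr0 // => -[a la] _.
by have := la; rewrite [X in (_ < X)%N](_ : _ = 0%N) // finset.setDv cards0.
Qed.

End Quasideterminant.

(* Rows and columns labelled 1, ..., n'.+1 as on paper; the label k stands for
   the ordinal of value k.-1. *)
Section Labels.
Variables (F : unitRingType) (n' : nat).
Local Notation n := n'.+1.

Definition lbl (k : nat) : 'I_n := inord k.-1.

(* The interval [a, b] of labels. *)
Definition seg (a b : nat) : {set 'I_n} := [set k : 'I_n | (a <= k.+1 <= b)%N]%SET.

Definition Delta_defined (x : 'M[F]_n) (I J : {set 'I_n}) (i j : nat) : Prop :=
  quasidet_defined x I J (lbl i) (lbl j).

Definition Delta (x : 'M[F]_n) (I J : {set 'I_n}) (i j : nat) : F :=
  qminor x I J (lbl i) (lbl j).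

End Labels.

Arguments seg {n'} a b.

Section Groups.
Variables (F : unitRingType) (n' : nat).
Local Notation n := n'.+1.
Implicit Types (x y : 'M[F]_n) (u v w : 'S_n).

Definition GLn : set 'M[F]_n := [set x | mx_invertible x].
Definition Bminus : set 'M[F]_n := [set x | GLn x /\ is_trig_mx x].
Definition Bplus : set 'M[F]_n := [set x | GLn x /\ is_trig_mx x^T].
Definition Hdiag : set 'M[F]_n := [set x | GLn x /\ is_diag_mx x].
Definition Uplus : set 'M[F]_n := [set x | Bplus x /\ forall i, x i i = 1].

(* [x]_- and [x]_+, meaningful for x in B^- U. *)
Definition gauss_dec x : 'M[F]_n * 'M[F]_n :=
  xget (0, 0) [set p | [/\ Bminus p.1, Uplus p.2 & x = p.1 *m p.2]].
Definition minus_part x := (gauss_dec x).1.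
Definition plus_part x := (gauss_dec x).2.

(* The matrix with u e_k = e_(u k); [perm_mx u] is its transpose. *)
Definition perm_rep u : 'M[F]_n := (perm_mx u)^T.

(* s_k for k : 'I_n' exchanges the ordinals k and k.+1. *)
Definition simple_refl (k : 'I_n') : 'S_n := tperm (inord k) (inord k.+1).

Definition simple_lift (k : 'I_n') : 'M[F]_n :=
  \matrix_(a, b) if (a == k :> nat) && (b == k.+1 :> nat) then -1
                 else (simple_refl k a == b)%:R.

(* s_(j_1) ... s_(j_l) = w with composition of functions, which is opposite to
   the product of 'S_n. *)
Definition word_for (js : seq 'I_n') w : Prop :=
  forall k, w k = foldr (fun j a => simple_refl j a) k js.

Definition reduced_word (js : seq 'I_n') w : Prop :=
  word_for js w /\ forall js', word_for js' w -> (size js <= size js')%N.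

Definition overline w : 'M[F]_n :=
  xget 0 [set M | exists2 js, reduced_word js w &
                  M = foldr (fun j A => simple_lift j *m A) 1%:M js].

Definition wo : 'S_n := perm (@rev_ord_inj n).

Definition double_coset (P : set 'M[F]_n) (w : 'M[F]_n) (Q : set 'M[F]_n)
    : set 'M[F]_n := [set p *m w *m q | p in P & q in Q].

Definition Guv u v : set 'M[F]_n :=
  double_coset Bplus (perm_rep u) Bplus `&`
  double_coset Bminus (perm_rep v) Bminus.

Definition Luv u v : set 'M[F]_n :=
  double_coset Uplus (overline u) Uplus `&`
  double_coset Bminus (perm_rep v) Bminus.

Definition Jmx : 'M[F]_n := diag_mx (\row_k (-1) ^+ k.+1).

Definition iota_inv x : 'M[F]_n := Jmx *m mxinv x *m Jmx.

(* psi^{u,v} on L^{u,v}. *)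
Definition twistL u v x : 'M[F]_n :=
  iota_inv (minus_part (x *m overline v^-1%g)) *m
  mxinv (iota_inv x) *m
  iota_inv (plus_part (mxinv (overline u) *m x)).

(* x = h x' with h in H and x' in L^{u,v}, meaningful for x in G^{u,v}. *)
Definition HL_dec u v x : 'M[F]_n * 'M[F]_n :=
  xget (0, 0) [set p | [/\ Hdiag p.1, Luv u v p.2 & x = p.1 *m p.2]].

Definition twist u v x : 'M[F]_n :=
  (HL_dec u v x).1 *m twistL u v (HL_dec u v x).2.

End Groups.

Arguments wo n' : clear implicits.

(* Main.v *)
Require Import Defs.
From HB Require Import structures.
From mathcomp Require Import all_boot all_order all_fingroup all_algebra.
From mathcomp Require classical_sets.
From mathcomp Require Import zify.

Set Implicit Arguments.
Unset Strict Implicit.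
Unset Printing Implicit Defensive.

Import GRing.Theory.
Local Open Scope ring_scope.

(**
   Write x = h x' and x' \overline{w_o} = m p with m in B^-, p in U, and let z
   be the U-part of \overline{u}^{-1} x'. Unfolding the twist gives
   psi(x) = h J q z^{-1} J with q = m^{-1} x', while x = h m q. A quasiminor of
   A in rows I and columns J, at position (i, j), is the i-th entry of A nu
   for the vector nu supported on J with nu_j = 1 and (A nu)_k = 0 for k in
   I \ {i}. If nu computes the quasiminor of psi(x) then, up to sign,
   t = z^{-1} J nu computes that of x: its support shrinks from [1, j] to
   [j + 1 - i, j] because q \overline{w_o} = p is unitriangular, hence q is
   antitriangular. So corresponding quasiminors of x and psi(x) differ by a
   left factor depending only on i, which cancels in the ratios.
*)

(** * Default values and two-sided inverses *)

Lemma xget_neq (T : choiceType) (x0 : T) (P : classical_sets.set T) :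
  classical_sets.xget x0 P <> x0 -> P (classical_sets.xget x0 P).
Proof. by case: classical_sets.xgetP. Qed.

Section Inverse.
Variable F : unitRingType.

Lemma mxinvP (m n : nat) (A : 'M[F]_(m, n)) :
  mx_invertible A -> mx_inverse A (mxinv A).
Proof. by move=> iA; apply: classical_sets.xgetPex. Qed.

Lemma mxinv_eq (m n : nat) (A : 'M[F]_(m, n)) (B : 'M[F]_(n, m)) :
  mx_inverse A B -> mxinv A = B.
Proof.
move=> [AB BA]; have [|_ CA] := @mxinvP m n A; first by exists B.
by rewrite -[LHS]mulmx1 -AB mulmxA CA mul1mx.
Qed.

Lemma mxinv_neq0 (m n : nat) (A : 'M[F]_(m, n)) :
  mxinv A <> 0 -> mx_invertible A.
Proof. by move=> /xget_neq iA; exists (mxinv A). Qed.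

Lemma mx_inverse0 (n' : nat) (B : 'M[F]_n'.+1) : ~ mx_inverse 0 B.
Proof. by case=> /esym/eqP; rewrite mul0mx oner_eq0. Qed.

Lemma mxinv0 (n' : nat) : mxinv (0 : 'M[F]_n'.+1) = 0.
Proof. by apply: classical_sets.xgetPN => B; apply: mx_inverse0. Qed.

Lemma diag_invertible_neq0 (n : nat) (h : 'M[F]_n) (r : 'I_n) :
  mx_invertible h -> is_diag_mx h -> h r r != 0.
Proof.
move=> [B [/matrixP/(_ r r) hB _]] /is_diag_mxP dh; apply/eqP => h0.
move: hB => /esym/eqP; rewrite !mxE eqxx big1 ?oner_eq0 // => k _.
have [-> | /eqP rk] := eqVneq k r; first by rewrite h0 mul0r.
by rewrite dh ?mul0r //; apply/eqP => /val_inj/esym.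
Qed.

End Inverse.

(** * Quasideterminants through test vectors *)

Section QuasidetVector.
Variables (F : unitRingType) (n : nat).
Implicit Types (x : 'M[F]_n) (nu : 'cV[F]_n) (I J : {set 'I_n}) (i j : 'I_n).

Lemma mulmx_supp (m : nat) (x : 'M[F]_(m, n)) nu J j k : j \in J ->
  (forall a, a \notin J -> nu a 0 = 0) ->
  (x *m nu) k 0 =
    x k j * nu j 0 +
    \sum_(l < #|J :\ j|) x k (enum_val l) * nu (enum_val l) 0.
Proof.
move=> jJ nuJ; rewrite mxE (bigD1 j) //=; congr (_ + _).
rewrite -(big_enum_val (fun a => x k a * nu a 0)) /=.
rewrite big_mkcond [RHS]big_mkcond; apply: eq_bigr => a _; rewrite !inE.
by case: eqP => //= _; case: ifPn => // /nuJ ->; rewrite mulr0.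
Qed.

(** Block elimination: the rows of [I :\ i] determine the coordinates of [nu] on [J :\ j] from
    [nu j 0], and substituting them into row [i] leaves the Schur complement. *)
Lemma quasidet_vec x I J i j nu : quasidet_defined x I J i j ->
  (forall a, a \notin J -> nu a 0 = 0) ->
  (forall k, k \in I :\ i -> (x *m nu) k 0 = 0) ->
  (x *m nu) i 0 = quasidet x I J i j * nu j 0.
Proof.
move=> [_ _ jJ iA] nuJ nuI; rewrite /quasidet.
set r := (\row_l _); set c := (\col_k _).
pose A := submx_of x (I :\ i) (J :\ j).
pose mu : 'cV[F]_#|J :\ j| := \col_l nu (enum_val l) 0.
have [_ BA] := mxinvP iA.
(* The scalar [nu j 0] multiplies on the right, hence the 1 by 1 matrix placed after [c]. *)
have Amu : A *m mu = - (c *m (nu j 0)%:M).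
  apply/matrixP => k l; rewrite ord1 !mxE big_ord1 !mxE eqxx mulr1n.
  have := nuI _ (enum_valP k); rewrite (mulmx_supp _ _ jJ nuJ).
  move/eqP; rewrite addrC addr_eq0 => /eqP <-.
  by apply: eq_bigr => a _; rewrite !mxE.
have -> : (x *m nu) i 0 = x i j * nu j 0 + (r *m mu) 0 0.
  rewrite (mulmx_supp _ _ jJ nuJ) mxE; congr (_ + _).
  by apply: eq_bigr => a _; rewrite !mxE.
rewrite -[mu]mul1mx -BA -mulmxA Amu !mulmxN !mulmxA.
by rewrite mxE mulrBl; congr (_ - _); rewrite mxE big_ord1 !mxE eqxx mulr1n.
Qed.

Lemma quasidet_vec_ex x I J i j : quasidet_defined x I J i j ->
  exists nu, [/\ forall a, a \notin J -> nu a 0 = 0, nu j 0 = 1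
    & forall k, k \in I :\ i -> (x *m nu) k 0 = 0].
Proof.
move=> [_ _ jJ iA].
pose A := submx_of x (I :\ i) (J :\ j).
pose c : 'cV[F]_#|I :\ i| := \col_k x (enum_val k) j.
pose v := mxinv A *m c.
(* The solution of the eliminated system: 1 at [j] and [- v] on [J :\ j], spread over all indices by
   indicator functions. *)
pose nu : 'cV[F]_n := \col_a ((a == j)%:R -
  \sum_(l < #|J :\ j|) (a == enum_val l)%:R * v l 0).
have [AB _] := mxinvP iA.
have nuJ a : a \notin J -> nu a 0 = 0.
  move=> aJ; rewrite mxE big1 ?subr0 => [|l _].
    by case: eqP aJ => // ->; rewrite jJ.
  move: (enum_val l) (enum_valP l) => b; rewrite !inE => /andP[_ bJ].
  by case: eqP aJ => [->|]; rewrite ?bJ // mul0r.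
have nuj : nu j 0 = 1.
  rewrite mxE eqxx big1 ?subr0 // => l _.
  move: (enum_val l) (enum_valP l) => b; rewrite !inE => /andP[bj _].
  by rewrite eq_sym (negPf bj) mul0r.
exists nu; split=> // k kI.
rewrite (mulmx_supp _ _ jJ nuJ) nuj mulr1.
have nuE l : nu (enum_val l) 0 = - v l 0.
  rewrite mxE (bigD1 l) //= eqxx mul1r big1 ?addr0 => [|l' ll'].
    move: (enum_val l) (enum_valP l) => b; rewrite !inE => /andP[bj _].
    by rewrite (negPf bj) sub0r.
  by rewrite (inj_eq enum_val_inj) eq_sym (negPf ll') mul0r.
have : (A *m v) (enum_rank_in kI k) 0 = x k j.
  by rewrite mulmxA AB mul1mx mxE enum_rankK_in.
rewrite mxE => <-; rewrite -big_split /= big1 // => l _.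
by rewrite nuE mxE enum_rankK_in // mulrN subrr.
Qed.

End QuasidetVector.

(** * Triangular, diagonal and monomial matrices acting on vectors *)

Section Triangular.
Variables (F : unitRingType) (n' : nat).
Local Notation n := n'.+1.
Implicit Types (z m : 'M[F]_n) (t : 'cV[F]_n).

Lemma Uplus_tail z t (j : nat) : Uplus z ->
  (forall k : 'I_n, (j <= k)%N -> (z *m t) k 0 = 0) ->
  forall k : 'I_n, (j <= k)%N -> t k 0 = 0.
Proof.
move=> [[_ /is_trig_mxP tz] z1] zt k.
(* Back substitution from the last row upwards, as an induction on [n - k]. *)
have [d] := ubnP (n - k)%N; elim: d k => // d IH k dk jk.
have := zt k jk; rewrite mxE (bigD1 k) //= z1 mul1r big1 ?addr0 // => l lk.
have [ll | kl] := ltnP l k.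
  by move: (tz l k ll); rewrite mxE => ->; rewrite mul0r.
have lk' : (l != k :> nat) by [].
by rewrite IH ?mulr0 //; have := ltn_ord l; have := ltn_ord k; lia.
Qed.

Lemma Uplus_last z t (j : 'I_n) : Uplus z ->
  (forall k : 'I_n, (j < k)%N -> t k 0 = 0) -> (z *m t) j 0 = t j 0.
Proof.
move=> [[_ /is_trig_mxP tz] z1] t0.
rewrite mxE (bigD1 j) //= z1 mul1r big1 ?addr0 // => l lj.
have [ll | jl] := ltnP l j.
  by have := tz l j ll; rewrite mxE => ->; rewrite mul0r.
have lj' : (l != j :> nat) by [].
by rewrite t0 ?mulr0 //; lia.
Qed.

Lemma trig_first m t (i : 'I_n) : is_trig_mx m ->
  (forall k : 'I_n, (k < i)%N -> t k 0 = 0) -> (m *m t) i 0 = m i i * t i 0.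
Proof.
move=> /is_trig_mxP tm t0.
rewrite mxE (bigD1 i) //= big1 ?addr0 // => l li.
have [ll | il] := ltnP l i; first by rewrite t0 ?mulr0.
have li' : (l != i :> nat) by [].
by rewrite tm ?mul0r //; lia.
Qed.

Lemma diag_mulmx (h : 'M[F]_n) t (i : 'I_n) :
  is_diag_mx h -> (h *m t) i 0 = h i i * t i 0.
Proof.
move=> /is_diag_mxP dh; rewrite mxE (bigD1 i) //= big1 ?addr0 // => l li.
by rewrite dh ?mul0r // eq_sym.
Qed.

Lemma Jmx_mulmx t (i : 'I_n) : (Jmx F n' *m t) i 0 = (-1) ^+ i.+1 * t i 0.
Proof. by rewrite /Jmx mul_diag_mx !mxE. Qed.

Lemma JmxK : Jmx F n' *m Jmx F n' = 1%:M.
Proof.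
apply/matrixP => a b; rewrite /Jmx mul_diag_mx !mxE.
by case: eqP => [->|]; rewrite ?mulr1n ?mulr0n ?mulr0 // -expr2 sqrr_sign.
Qed.

(** A product of monomial matrices is monomial, with the product permutation as its pattern. The
    default value 0 satisfies the claim trivially. *)
Lemma overline_supp (w : 'S_n) (a b : 'I_n) : a != w b -> overline F w a b = 0.
Proof.
rewrite /overline; case: classical_sets.xgetP => [M _ [js [jsw _] ->] | _];
  last by rewrite mxE.
rewrite jsw; elim: js {jsw M} a b => [|j js IH] a b /=.
  by rewrite mxE => /negPf ->.
move=> ab; rewrite mxE big1 // => c _.
have [cb | /IH ->] := eqVneq c (foldr (fun j a => simple_refl j a) b js);
  last by rewrite mulr0.
rewrite cb mxE.
(* The entry -1 of [simple_lift j] also lies on the pattern of the transposition, so this case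
   contradicts [ab]. *)
case: ifPn => [/andP[/eqP aj /eqP bj] | _].
  case/eqP: ab; rewrite /simple_refl.
  have -> : a = inord j.
    by apply: val_inj; rewrite /= inordK // ltnW // ltnS ltn_ord.
  have -> : foldr (fun j a => simple_refl j a) b js = inord j.+1.
    by apply: val_inj; rewrite /= inordK // ltnS ltn_ord.
  by rewrite tpermR.
case: eqP => [E|]; last by rewrite mul0r.
by case/eqP: ab; rewrite -E /simple_refl tpermK.
Qed.

Lemma wo_invE (k : 'I_n) : ((wo n')^-1)%g k = rev_ord k.
Proof. by apply: (@perm_inj _ (wo n')); rewrite permKV permE rev_ordK. Qed.

Lemma overline_wo_mulmx t (a : 'I_n) :
  (overline F (wo n')^-1%g *m t) a 0 =
  overline F (wo n')^-1%g a (rev_ord a) * t (rev_ord a) 0.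
Proof.
rewrite mxE (bigD1 (rev_ord a)) //= big1 ?addr0 // => b ba.
rewrite overline_supp ?mul0r // wo_invE; apply: contraNneq ba => ->.
by rewrite rev_ordK.
Qed.

End Triangular.

(** * Factorization of the twist and comparison of quasiminors *)

Section Twist.
Variables (F : unitRingType) (n' : nat).
Local Notation n := n'.+1.

Lemma iota_inv_neq0 (x : 'M[F]_n) : iota_inv x <> 0 -> mx_invertible x.
Proof.
move=> nz; apply: mxinv_neq0 => x0.
by apply: nz; rewrite /iota_inv x0 mulmx0 mul0mx.
Qed.

Lemma gauss_dec_neq0 (x : 'M[F]_n) : gauss_dec x <> (0, 0) ->
  [/\ Bminus (minus_part x), Uplus (plus_part x)
    & x = minus_part x *m plus_part x].
Proof. exact: xget_neq. Qed.

(* A nonzero twist forces all the decompositions used in its definition to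
   exist, since the default value is 0. *)
Lemma twist_factor (u : 'S_n) (x : 'M[F]_n) : twist u (wo n') x <> 0 ->
  exists h m p q z z' : 'M[F]_n,
    [/\ Hdiag h, Bminus m, Uplus p & Uplus z] /\
    [/\ mx_inverse z z', q *m overline F (wo n')^-1%g = p, mx_invertible q,
      x = h *m m *m q
      & twist u (wo n') x = h *m Jmx F n' *m q *m z' *m Jmx F n'].
Proof.
rewrite /twist => ynz.
have /xget_neq[] : HL_dec u (wo n') x <> (0, 0).
  by move=> E; apply: ynz; rewrite E mul0mx.
rewrite -/(HL_dec u (wo n') x); case: (HL_dec u (wo n') x) ynz => h x1 /= ynz.
move=> hH _ xE.
have {}ynz : twistL u (wo n') x1 <> 0.
  by move=> E; apply: ynz; rewrite E mulmx0.
move: ynz; rewrite /twistL.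
set a := x1 *m _; set b := _ *m x1 => ynz.
have mi : mx_invertible (minus_part a).
  by apply: iota_inv_neq0 => E; apply: ynz; rewrite E !mul0mx.
have zi : mx_invertible (plus_part b).
  by apply: iota_inv_neq0 => E; apply: ynz; rewrite E !mulmx0.
have xi : mx_invertible x1.
  apply: iota_inv_neq0 => E; apply: ynz.
  by rewrite E mxinv0 mulmx0 mul0mx.
have not0 (A : 'M[F]_n) : mx_invertible A -> A <> 0.
  by move=> [B AB] A0; move: AB; rewrite A0 => /mx_inverse0.
have [mB pU aE] : [/\ Bminus (minus_part a), Uplus (plus_part a)
    & a = minus_part a *m plus_part a].
  by apply: gauss_dec_neq0 => E; apply: (not0 _ mi); rewrite /minus_part E.
have [_ zU _] : [/\ Bminus (minus_part b), Uplus (plus_part b)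
    & b = minus_part b *m plus_part b].
  by apply: gauss_dec_neq0 => E; apply: (not0 _ zi); rewrite /plus_part E.
have [mm' m'm] := mxinvP mi.
have [xx' x'x] := mxinvP xi.
(* Since J is an involution, the inverse of J x^-1 J is J x J. *)
have iotaV : mxinv (iota_inv x1) = Jmx F n' *m x1 *m Jmx F n'.
  apply: mxinv_eq; rewrite /iota_inv; split.
    rewrite !mulmxA -[_ *m Jmx F n' *m Jmx F n']mulmxA JmxK mulmx1.
    by rewrite -[_ *m mxinv x1 *m x1]mulmxA x'x mulmx1 JmxK.
  rewrite !mulmxA -[_ *m Jmx F n' *m Jmx F n']mulmxA JmxK mulmx1.
  by rewrite -[_ *m x1 *m mxinv x1]mulmxA xx' mulmx1 JmxK.
exists h, (minus_part a), (plus_part a), (mxinv (minus_part a) *m x1),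
  (plus_part b), (mxinv (plus_part b)); split; split=> //.
- exact: mxinvP.
- by rewrite -mulmxA -/a [X in _ *m X]aE mulmxA m'm mul1mx.
- exists (mxinv x1 *m minus_part a); split.
    by rewrite mulmxA -[_ *m x1 *m _]mulmxA xx' mulmx1.
  by rewrite mulmxA -[_ *m minus_part a *m _]mulmxA mm' mulmx1.
- by rewrite xE !mulmxA -[h *m _ *m _]mulmxA mm' mulmx1.
(* The twist is h (J m^-1 J)(J x1 J)(J z^-1 J), and the two inner products J J cancel. *)
- rewrite iotaV /iota_inv !mulmxA.
  rewrite -[_ *m Jmx F n' *m Jmx F n']mulmxA JmxK mulmx1.
  by rewrite -[_ *m Jmx F n' *m Jmx F n']mulmxA JmxK mulmx1.
Qed.

Lemma lbl_val (k : nat) : (0 < k <= n)%N -> lbl n' k = k.-1 :> nat.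
Proof. by move=> kn; rewrite /lbl inordK //; lia. Qed.

Lemma num_gt_seg_last (a k : nat) :
  (0 < k <= n)%N -> num_gt (seg a k) (lbl n' k) = 0%N.
Proof.
move=> kn; apply/eqP; rewrite cards_eq0; apply/eqP/setP => r.
by rewrite !inE lbl_val //; lia.
Qed.

(** As [k <= n], the upper segment lies wholly beyond [i], so it consists of exactly the labels to
    count: the last [k - i] ones, enumerated by reversal. *)
Lemma num_gt_seg_gap (i k : nat) : (0 < i)%N -> (i <= k <= n)%N ->
  num_gt (seg 1 i :|: seg (n + i + 1 - k) n) (lbl n' i) = (k - i)%N.
Proof.
move=> i0 ikn; rewrite /num_gt.
have kn : (k - i <= n)%N by lia.
rewrite -[RHS]card_ord -(card_imset (mem 'I_(k - i)) (f := fun r =>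
  rev_ord (widen_ord kn r))); last first.
  by move=> r s /rev_ord_inj/(congr1 val) /= rs; apply: val_inj.
apply: eq_card => r; rewrite !inE lbl_val; last by lia.
apply/idP/imsetP => [H | [s _ ->] /=]; last by have := ltn_ord s; lia.
have rk : (n' - r < k - i)%N by have := ltn_ord r; lia.
exists (Ordinal rk) => //; apply: val_inj => /=.
by have := ltn_ord r; lia.
Qed.

(** The factor [c] is chosen before [k], so it is common to the quasiminors for [j] and [j + 1] and
    cancels in their ratio. *)
Lemma Delta_twist (hF : skew_field F) (u : 'S_n) (x : 'M[F]_n) (i : nat) :
  (0 < i)%N -> let y := twist u (wo n') x in y <> 0 ->
  exists c : F, forall k : nat, (i <= k <= n)%N ->
    Delta_defined y (seg 1 i :|: seg (n + i + 1 - k) n) (seg 1 k) i k ->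
    Delta_defined x (seg 1 i) (seg (k + 1 - i) k) i k ->
    Delta x (seg 1 i) (seg (k + 1 - i) k) i k =
    c * Delta y (seg 1 i :|: seg (n + i + 1 - k) n) (seg 1 k) i k.
Proof.
move=> i0 y /twist_factor[h [m [p [q [z [z' [[hH mB pU zU] E]]]]]]].
have [[zz' _] qv [qi [_ qiq]] xE yE] := E => {E}.
have [hi hd] := hH; have [_ mt] := mB.
have hr r : h r r \is a GRing.unit.
  by apply: hF; apply: diag_invertible_neq0.
pose li := lbl n' i.
(* Up to the same sign, the two quasiminors are h_i m_i (q t)_i for [x] and h_i (q t)_i for [y]; the
   conjugation by h_i is there because scalars need not commute. *)
exists (h li li * m li li * (h li li)^-1) => k ikn dy dx.
have liE : li = i.-1 :> nat by rewrite lbl_val //; lia.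
have lkE : lbl n' k = k.-1 :> nat by rewrite lbl_val //; lia.
have [nu [nuJ nu1 nuI]] := quasidet_vec_ex dy.
have yi := quasidet_vec dy nuJ nuI.
rewrite nu1 mulr1 in yi.
pose t := z' *m (Jmx F n' *m nu).
have zt : z *m t = Jmx F n' *m nu by rewrite mulmxA zz' mul1mx.
have t_hi (a : 'I_n) : (k <= a)%N -> t a 0 = 0.
  apply: Uplus_tail zU _ a => a ka.
  by rewrite zt Jmx_mulmx nuJ ?mulr0 // inE; lia.
have t_last : t (lbl n' k) 0 = (-1) ^+ k.
  rewrite -(Uplus_last zU) => [|a ka]; last by apply: t_hi; lia.
  by rewrite zt Jmx_mulmx nu1 mulr1 lkE prednK //; lia.
have ynu r : (y *m nu) r 0 = h r r * ((-1) ^+ r.+1 * (q *m t) r 0).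
  rewrite /y yE -!mulmxA -/t diag_mulmx //.
  by rewrite Jmx_mulmx.
have qt0 r : r \in (seg 1 i :|: seg (n + i + 1 - k) n) :\ li -> (q *m t) r 0 = 0.
  move=> /nuI; rewrite ynu => /(canRL (mulKr (hr r))); rewrite mulr0.
  by move/(canRL (signrMK _)); rewrite mulr0.
have [p' [pp' _]] : mx_invertible p by have [[]] := pU.
pose s := p' *m (q *m t).
have ps : p *m s = q *m t by rewrite mulmxA pp' mul1mx.
have vs : overline F (wo n')^-1%g *m s = t.
  have -> : overline F (wo n')^-1%g = qi *m p by rewrite -qv mulmxA qiq mul1mx.
  by rewrite -mulmxA ps mulmxA qiq mul1mx.
(* The last [k - i] rows of q t = p s vanish, and p is upper unitriangular. The bound is an ordinal,
   one less than the label n + i + 1 - k. *)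
have s0 (a : 'I_n) : (n + i - k <= a)%N -> s a 0 = 0.
  apply: Uplus_tail pU _ a => a ka; rewrite ps qt0 // !inE -val_eqE /= liE.
  by have := ltn_ord a; lia.
have tJ (a : 'I_n) : a \notin seg (k + 1 - i) k -> t a 0 = 0.
  rewrite inE => ka; have [/t_hi // | ak] := leqP k a.
  (* The lift of the longest permutation reverses indices, so the zero tail of [s] becomes a zero
     head of [t]. *)
  by rewrite -vs overline_wo_mulmx s0 ?mulr0 //=; lia.
have qt_lo (r : 'I_n) : (r < li)%N -> (q *m t) r 0 = 0.
  by move=> ri; rewrite qt0 // !inE -val_eqE /=; lia.
(* As q t vanishes above row [li], the lower triangular m contributes only its diagonal entry. *)
have xt (r : 'I_n) : (r <= li)%N -> (x *m t) r 0 = h r r * (m r r * (q *m t) r 0).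
  move=> rl; rewrite xE -!mulmxA diag_mulmx //.
  by rewrite (trig_first mt) // => a ar; apply: qt_lo; lia.
have tI r : r \in seg 1 i :\ li -> (x *m t) r 0 = 0.
  rewrite !inE -val_eqE /= => H.
  by rewrite xt ?qt_lo ?mulr0 //; lia.
have := quasidet_vec dx tJ tI.
rewrite t_last xt // => xi; move: yi; rewrite ynu liE prednK // => yi.
rewrite /Delta /qminor !num_gt_seg_last ?num_gt_seg_gap; try lia.
rewrite expr0 mul1r addn0 -yi -/li.
have -> : quasidet x (seg 1 i) (seg (k + 1 - i) k) li (lbl n' k) =
    h li li * (m li li * (q *m t) li 0) * (-1) ^+ k.
  by rewrite xi -mulrA -expr2 sqrr_sign mulr1.
(* The signs agree: (-1)^k from [t_last] for [x], and (-1)^(k-i) from the index count times (-1)^i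
   from J for [y]. *)
rewrite [_ * (h li li * _)]mulrA -(commr_sign (h li li)) -!mulrA mulKr //.
by rewrite [_ ^+ (k - i) * _]mulrA -exprD subnK -?commr_sign //; lia.
Qed.

End Twist.

(** * Ratios of quasiminors *)

Theorem corollary5p3 (F : unitRingType) (hF : skew_field F) (n' : nat) :
  let n := n'.+1 in
  forall (u : 'S_n) (x : 'M[F]_n), Guv u (wo n') x ->
  let y := twist u (wo n') x in
  (forall i j : nat, (1 <= i)%N -> (i <= j)%N -> (j <= n - 1)%N ->
     [/\ Delta_defined y (seg 1 i :|: seg (n + i + 1 - j) n) (seg 1 j) i j,
         Delta y (seg 1 i :|: seg (n + i + 1 - j) n) (seg 1 j) i j <> 0 &
         Delta_defined y (seg 1 i :|: seg (n + i - j) n)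
           (seg 1 (j + 1)) i (j + 1)] /\
     [/\ Delta_defined x (seg 1 i) (seg (j + 1 - i) j) i j,
         Delta x (seg 1 i) (seg (j + 1 - i) j) i j <> 0 &
         Delta_defined x (seg 1 i) (seg (j - i + 2) (j + 1)) i (j + 1)]) ->
  forall i j : nat, (1 <= i)%N -> (i <= j)%N -> (j <= n - 1)%N ->
    (Delta y (seg 1 i :|: seg (n + i + 1 - j) n) (seg 1 j) i j)^-1 *
      Delta y (seg 1 i :|: seg (n + i - j) n) (seg 1 (j + 1)) i (j + 1) =
    (Delta x (seg 1 i) (seg (j + 1 - i) j) i j)^-1 *
      Delta x (seg 1 i) (seg (j - i + 2) (j + 1)) i (j + 1).
Proof.
move=> n u x _ y hyp i j i1 ij jn.
have [[dy /eqP ny dy1] [dx /eqP nx dx1]] := hyp i j i1 ij jn.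
(* Every quasiminor of the zero matrix is 0, while one of [y] is nonzero by hypothesis. *)
have y0 : y <> 0.
  move=> y0; case/eqP: ny; rewrite /Delta /qminor /quasidet y0 mxE.
  rewrite [X in X *m _ *m _](_ : _ = 0) ?mul0mx ?mxE ?subr0 ?mulr0 //.
  by apply/matrixP => a b; rewrite !mxE.
have [c Dc] := Delta_twist hF i1 y0.
have ijn : (i <= j <= n)%N by lia.
have ijn1 : (i <= j + 1 <= n)%N by lia.
have En : (n + i - j = n'.+1 + i + 1 - (j + 1))%N by lia.
have Ej : (j - i + 2 = j + 1 + 1 - i)%N by lia.
rewrite En Ej in dy1 dx1 *.
move: nx; rewrite (Dc j ijn dy dx) (Dc _ ijn1 dy1 dx1) => nx.
(* The nonzero quasiminor of [x] is a left multiple by [c], so [c] is nonzero. *)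
have uc : c \is a GRing.unit.
  by apply: hF; apply: contraNneq nx => ->; rewrite mul0r.
rewrite invrM //; last exact: hF.
by rewrite -mulrA mulKr.
Qed.
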